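(* Fix a positive integer $d$ and a partition $\lambda$ of $d$, and let $J^{(1)},\dots,J^{(l)}$, $A$, $\mathbf{b}$, $\mathbf{c}$, $LP_\cap$, $LP_{\cap,=}$, $LP_\cap^\vee$ be as in the context. Let $J=\bigcap_jJ^{(j)}$, let $\mathbb{R}^m_{\ge0}=\{\sum_ix_iw^i:x_i\ge0\}\subseteq\mathbb{R}\mathcal{U}_d$, and set $M=\mathbf{c}^T\mathfrak{J}_\lambda(\mathbf{u})$. The following are equivalent: (i) $\mathfrak{J}_\lambda(\mathbf{u})$ lies in the image of $\mathbb{R}^m_{\ge0}$ in $\mathbb{R}\mathcal{U}_d/\mathbb{R}J_d$; (ii) $LP_{\cap,=}$ is feasible; (iii) $LP_\cap$ has optimal value $M$; (iv) $LP_\cap^\vee$ has optimal value $M$; (v) for every $\mathbf{g}\in\sum_j\big((\mathbb{R}J^{(j)}_d)^\perp\cap\mathbb{R}^m_{\ge0}\big)$ with $\mathbf{g}\le\mathbf{c}$, $\langle\mathfrak{J}_\lambda(\mathbf{u}),\mathbf{c}-\mathbf{g}\rangle\ge0$.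
   Context: $\mathcal{U}=\mathbb{Z}\langle u_1,\dots,u_N\rangle$, monomials = words in $\{1,\dots,N\}$; $\mathcal{U}_d$ is the degree-$d$ component, $J_d$ the degree-$d$ component of a homogeneous ideal $J$; $\mathbb{R}\mathcal{U}_d=\mathbb{R}\otimes\mathcal{U}_d$. $\langle\cdot,\cdot\rangle$ is the bilinear form with words orthonormal, $\perp$ the orthogonal complement. $\mathcal{W}_d$ is the set of words of length $d$ without repeated letter. $I_{\mathrm{KR}}^{\mathrm{st}}$ is the two-sided ideal generated by $b(ac-ca)-(ac-ca)b$ ($a<b<c$) and all words with a repeated letter. A bijectivization of $\mathcal{U}/I_{\mathrm{KR}}^{\mathrm{st}}$ is $\mathcal{U}/J'$ with $J'\supseteq I_{\mathrm{KR}}^{\mathrm{st}}$ generated by words and binomials $v-w$ with $v,w$ words of equal length; words $v,w$ are equivalent if $v-w\in J'$, a word is nonzero if not in $J'$, and a class is nonzero if all its elements are nonzero. $\mathfrak{J}_\lambda(\mathbf{u})=\sum_{\pi\in S_t}\mathrm{sgn}(\pi)e_{\lambda'_1+\pi(1)-1}(\mathbf{u})\cdots e_{\lambda'_t+\pi(t)-t}(\mathbf{u})$ with $e_d(\mathbf{u})=\sum_{N\ge i_1>\cdots>i_d\ge1}u_{i_1}\cdots u_{i_d}$, $\lambda'$ conjugate, $t=\lambda_1$. Let $w^1,\dots,w^m$ be all words of length $d$; identify $\mathbf{x}\in\mathbb{R}^m$ with $\sum_ix_iw^i\in\mathbb{R}\mathcal{U}_d$. Let $J^{(1)},\dots,J^{(l)}$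 be ideals of $\mathcal{U}$ such that each $\mathcal{U}/J^{(j)}$ is a bijectivization of $\mathcal{U}/I_{\mathrm{KR}}^{\mathrm{st}}$ and the union of its nonzero equivalence classes of degree $d$ is $\mathcal{W}_d$. For each $j$, let $h^{(j)}_1,\dots,h^{(j)}_{t_j}\in\{0,1\}^m$ be the indicator vectors of the nonzero equivalence classes of $\mathcal{U}/J^{(j)}$ of degree $d$; $A_j$ is the $t_j\times m$ matrix with rows $h^{(j)}_i$, $A$ is $A_1,\dots,A_l$ stacked vertically, $\mathbf{b}^j=A_j\mathfrak{J}_\lambda(\mathbf{u})$ and $\mathbf{b}$ is $\mathbf{b}^1,\dots,\mathbf{b}^l$ stacked; $\mathbf{c}\in\{0,1\}^m$ is the indicator vector of $\mathcal{W}_d$. $LP_\cap$: minimize $\mathbf{c}^T\mathbf{x}$ subject to $A\mathbf{x}\ge\mathbf{b}$, $\mathbf{x}\ge\mathbf{0}$. $LP_{\cap,=}$: the same with $A\mathbf{x}=\mathbf{b}$. $LP_\cap^\vee$: maximize $\mathbf{b}^T\mathbf{y}$ subject to $A^T\mathbf{y}\le\mathbf{c}$, $\mathbf{y}\ge\mathbf{0}$. Inequalities between vectors are coordinatewise. *)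

(* Defs.v *)
From HB Require Import structures.
From mathcomp Require Import all_boot all_order all_algebra.
From mathcomp Require Import perm finmap.
From mathcomp Require Import boolp classical_sets reals.
From mathcomp.multinomials Require Import monalg.

Set Implicit Arguments.
Unset Strict Implicit.
Unset Printing Implicit Defensive.

Import Order.TTheory GRing.Theory Num.Theory.
Local Open Scope classical_set_scope.
Local Open Scope ring_scope.

(* Z<u_1, ..., u_N>; the letter i : 'I_N stands for i + 1. *)
Definition ncpoly (N : nat) := {malg int[{fmonom 'I_N}]}.

Definition word (N : nat) (s : seq 'I_N) : ncpoly N := << FMonom s >>.

Section Ideals.
Variable N : nat.
Implicit Types (I J : set (ncpoly N)).

Definition two_sided_ideal I : Prop :=
  [/\ I 0,
      forall x y, I x -> I y -> I (x + y) &
      forall a x b, I x -> I (a * x * b)].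

Definition ideal_gen (S : set (ncpoly N)) : set (ncpoly N) :=
  smallest two_sided_ideal S.

Definition KR_generators : set (ncpoly N) :=
  [set x | exists a b c : 'I_N, [/\ (a < b)%N, (b < c)%N &
     x = word [:: b] * (word [:: a; c] - word [:: c; a])
         - (word [:: a; c] - word [:: c; a]) * word [:: b]]]
  `|` [set word s | s in [set s : seq 'I_N | ~~ uniq s]].

Definition I_KR_st : set (ncpoly N) := ideal_gen KR_generators.

Definition words_and_binomials : set (ncpoly N) :=
  [set x | exists s, x = word s]
  `|` [set x | exists v w, size v = size w /\ x = word v - word w].

(* ncpoly N / J is a bijectivization of ncpoly N / I_KR_st *)
Definition bijectivization J : Prop :=
  I_KR_st `<=` J /\
  exists2 G, G `<=` words_and_binomials & J = ideal_gen G.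

Definition homog_comp (d : nat) J : set (ncpoly N) :=
  [set g | J g /\ forall k : {fmonom 'I_N}, k \in msupp g -> size k = d].

Definition word_equiv J (v w : seq 'I_N) : bool := `[< J (word v - word w) >].

Definition nonzero_word J (w : seq 'I_N) : bool := ~~ `[< J (word w) >].

(* For a homogeneous ideal, words of different lengths can only be equivalent
   when both are zero, so a nonzero class contains words of one length only. *)
Definition nonzero_classes (d : nat) J : {set {set d.-tuple 'I_N}} :=
  [set C in equivalence_partition (fun v w : d.-tuple 'I_N => word_equiv J v w)
                                  [set: d.-tuple 'I_N]
   | [forall w in C, nonzero_word J w]]%SET.

Definition distinct_words (d : nat) : {set d.-tuple 'I_N} :=
  [set w : d.-tuple 'I_N | uniq w]%SET.

End Ideals.

Section SchurFunctions.
Variable N : nat.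

Definition elem_nat (d : nat) : ncpoly N :=
  \sum_(s : d.-tuple 'I_N | sorted (fun i j : 'I_N => (j < i)%N) s) word s.

(* e_d = 0 for d < 0 *)
Definition elem (d : int) : ncpoly N :=
  match d with Posz n => elem_nat n | Negz _ => 0 end.

Definition is_partition (d : nat) (lam : seq nat) : Prop :=
  [/\ sorted geq lam, all (fun p => 0 < p)%N lam & sumn lam = d].

(* i is 0-based: this is the (i + 1)-st part of the conjugate partition. *)
Definition conj_part (lam : seq nat) (i : nat) : nat :=
  count (fun p => i < p)%N lam.

Definition nc_schur (lam : seq nat) : ncpoly N :=
  \sum_(s : 'S_(head 0%N lam))
    (-1) ^+ s * \prod_(i < head 0%N lam)
                  elem ((conj_part lam i)%:Z + (s i)%:Z - i%:Z).

End SchurFunctions.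

Section RealVectors.
Variable R : realType.

Definition lev m (x y : 'cV[R]_m) : Prop := forall i, x i 0 <= y i 0.

Definition nonneg_vec m : set 'cV[R]_m := [set x | lev 0 x].

Definition dot m (x y : 'cV[R]_m) : R := (x^T *m y) 0 0.

Definition real_span m (S : set 'cV[R]_m) : set 'cV[R]_m :=
  [set v | exists k (a : 'I_k -> R) (g : 'I_k -> 'cV[R]_m),
     (forall i, S (g i)) /\ v = \sum_i a i *: g i].

Definition orth m (S : set 'cV[R]_m) : set 'cV[R]_m :=
  [set v | forall s, S s -> dot v s = 0].

Definition sum_sets m l (K : 'I_l -> set 'cV[R]_m) : set 'cV[R]_m :=
  [set \sum_j g j | g in [set g : 'I_l -> 'cV[R]_m | forall j, K j (g j)]].

Definition coset m (V : set 'cV[R]_m) (x : 'cV[R]_m) : set 'cV[R]_m :=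
  [set y | V (y - x)].

Definition optimal_min m (obj : 'cV[R]_m) (F : set 'cV[R]_m) (v : R) : Prop :=
  (exists2 x, F x & dot obj x = v) /\ forall x, F x -> v <= dot obj x.

Definition optimal_max m (obj : 'cV[R]_m) (F : set 'cV[R]_m) (v : R) : Prop :=
  (exists2 x, F x & dot obj x = v) /\ forall x, F x -> dot obj x <= v.

End RealVectors.

(* The degree d component of R (x) ncpoly N is 'cV[R]_(num_words N d), in the
   basis of words of length d. *)
Definition num_words (N d : nat) : nat := #|{: d.-tuple 'I_N}|.

Definition nth_word (N d : nat) (i : 'I_(num_words N d)) : d.-tuple 'I_N :=
  enum_val i.

Section LinearPrograms.
Variables (R : realType) (N d : nat).
Local Notation m := (num_words N d).

(* The degree d component of g, with real coefficients. *)
Definition coords (g : ncpoly N) : 'cV[R]_m :=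
  \col_i (g@_(FMonom (nth_word i)))%:~R.

Definition real_comp (J : set (ncpoly N)) : set 'cV[R]_m :=
  real_span [set coords g | g in homog_comp d J].

Definition cvec : 'cV[R]_m := \col_i (nth_word i \in distinct_words N d)%:R.

Definition num_classes (J : set (ncpoly N)) : nat := #|nonzero_classes d J|.

Definition class_mx (J : set (ncpoly N)) : 'M[R]_(num_classes J, m) :=
  \matrix_(i, k) (nth_word k \in (enum_val i : {set d.-tuple 'I_N}))%:R.

Section Stacked.
Variables (l : nat) (J : 'I_l -> set (ncpoly N)).

Definition stacked_mx : 'M[R]_(\sum_j num_classes (J j), m) :=
  \mxcol_j class_mx (J j).

Definition bvec (lam : seq nat) : 'cV[R]_(\sum_j num_classes (J j)) :=
  \mxcol_j (class_mx (J j) *m coords (nc_schur N lam)).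

Definition LP_cap_feasible lam : set 'cV[R]_m :=
  [set x | lev (bvec lam) (stacked_mx *m x) /\ lev 0 x].

Definition LP_cap_eq_feasible lam : set 'cV[R]_m :=
  [set x | stacked_mx *m x = bvec lam /\ lev 0 x].

Definition LP_cap_dual_feasible : set 'cV[R]_(\sum_j num_classes (J j)) :=
  [set y | lev (stacked_mx^T *m y) cvec /\ lev 0 y].

End Stacked.
End LinearPrograms.

Arguments nonneg_vec {R m}.
Arguments real_comp R {N} d J.
Arguments bvec R {N} d {l} J lam.
Arguments LP_cap_feasible R {N} d {l} J lam.
Arguments LP_cap_eq_feasible R {N} d {l} J lam.
Arguments LP_cap_dual_feasible R {N} d {l} J.

(* Main.v *)
(* The class indicators of J^(j) span the orthogonal complement of R J^(j)_d,
   since an ideal generated by words and binomials meets degree d in the common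
   kernel of the class sums. Hence R J_d is the kernel of A: the inclusion of
   the kernel uses that A has integer entries, so that its real kernel is
   spanned by integer vectors. This gives (i) <-> (ii). The classes of each
   J^(j) partition W_d, so the vector y0 with all entries 1/l satisfies
   A^T y0 = c; it is dual feasible with value M, so that weak duality yields
   (ii) -> (iii) -> (iv), and (iv) -> (v) is a reformulation. If (ii) fails,
   Farkas' lemma gives y with A^T y <= 0 and b^T y > 0. Since y0 is positive, a
   small positive multiple of y can be added to it, which contradicts (v). *)
From HB Require Import structures.
Require Import Defs.
From mathcomp Require Import all_boot all_order all_algebra.
From mathcomp Require Import boolp classical_sets reals.
From mathcomp Require Import finmap.
From mathcomp.multinomials Require Import monalg.

Set Implicit Arguments.
Unset Strict Implicit.
Unset Printing Implicit Defensive.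

Import Order.TTheory GRing.Theory Num.Theory.
Local Open Scope classical_set_scope.
Local Open Scope ring_scope.

(** * Farkas' lemma and integral spanning sets of kernels *)

(* Induction on the columns (Bartl): if the remaining columns [B] do not suffice,
   some [y1] separates [b] from [B] with [y1 *m a = 1], and the induction
   hypothesis applies after projecting along [a] onto the kernel of [y1]. *)
Lemma farkas (F : realFieldType) p n (A : 'M[F]_(p, n)) (b : 'cV[F]_p) :
    (forall y : 'rV_p, (forall k, (y *m A) 0 k <= 0) -> (y *m b) 0 0 <= 0) ->
  exists2 x : 'cV_n, (forall k, 0 <= x k 0) & A *m x = b.
Proof.
elim: n => [|n IHn] in p A b *.
  (* With no columns every [y] is admissible; testing against plus and minus the unit row vectors
     forces [b = 0]. *)
  move=> Ab; exists 0 => [[]//|]; rewrite mulmx0; apply/esym/colP => i.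
  have bi (a : F) : ((a *: delta_mx 0 i : 'rV_p) *m b) 0 0 = a * b i 0.
    by rewrite -scalemxAl -rowE !mxE.
  apply/eqP; rewrite mxE eq_le -{1}[b i 0]mul1r -bi Ab ?[X in X -> _]/=;
    last by case.
  by rewrite -oppr_le0 -mulN1r -bi Ab // => -[].
rewrite -[n.+1]/(1 + n)%N in A *.
rewrite -[A]hsubmxK; move: (lsubmx A) (rsubmx A) => {A} a B Ab.
have [AbB|] := pselect (forall y : 'rV_p,
    (forall k, (y *m B) 0 k <= 0) -> (y *m b) 0 0 <= 0).
  have [x x0 <-] := IHn _ _ _ AbB; exists (col_mx (0 : 'cV_1) x) => [k|].
    by rewrite mxE; case: splitP => // j _; rewrite mxE.
  by rewrite mul_row_col mulmx0 add0r.
move=> /existsNP[y1] /not_implyP[y1B /negP]; rewrite -ltNge => y1b.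
have y1a : 0 < (y1 *m a) 0 0.
  rewrite ltNge; apply: contraL y1b => y1a; rewrite -leNgt; apply: Ab => k.
  by rewrite mul_mx_row mxE; case: splitP => j _ //; rewrite (ord1 j).
wlog y1a1 : y1 y1B y1b {y1a} / y1 *m a = 1%:M.
  move=> /(_ (((y1 *m a) 0 0)^-1 *: y1)); apply.
  - by move=> k; rewrite -scalemxAl mxE pmulr_rle0 ?invr_gt0.
  - by rewrite -scalemxAl mxE pmulr_rgt0 ?invr_gt0.
  - by rewrite -scalemxAl {2}[y1 *m a]mx11_scalar scale_scalar_mx mulVf ?gt_eqF.
pose P : 'M[F]_p := 1%:M - a *m y1.
have yPE m (y : 'rV_p) (C : 'M_(p, m)) : y *m (P *m C) = y *m P *m C.
  by rewrite mulmxA.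
have [y|x x0 xE] := IHn _ (P *m B) (P *m b).
  rewrite !yPE => yB; apply: Ab => k; rewrite mul_mx_row mxE.
  case: splitP => j _ //; rewrite /P mulmxBr mulmx1 mulmxBl -!mulmxA y1a1.
  by rewrite mulmx1 subrr mxE.
(* Applying [P] changes [B *m x] and [b] only by multiples of [a]; the coefficient of [a] restores
   them. It is nonnegative because [y1 *m b] is positive and [y1 *m B] is nonpositive. *)
exists (col_mx (y1 *m b - y1 *m B *m x) x) => [k|].
  rewrite mxE; case: splitP => // j _; rewrite (ord1 j) mxE.
  rewrite [X in _ + X]mxE subr_ge0.
  apply: le_trans (ltW y1b); rewrite mxE.
  by apply: sumr_le0 => i _; rewrite mulr_le0_ge0.
rewrite mul_row_col mulmxBr; move: xE.
rewrite /P !mulmxBl !mul1mx -!mulmxA => xE.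
by rewrite -addrA [- _ + _]addrC xE addrC subrK.
Qed.

Lemma rat_common_denom m n (A : 'M[rat]_(m, n)) :
  exists2 q : int, q != 0 &
    exists B : 'M[int]_(m, n), q%:~R *: A = map_mx intr B.
Proof.
pose q : int := \prod_i \prod_j denq (A i j).
exists q.
  by apply/prodf_neq0 => i _; apply/prodf_neq0 => j _; rewrite denq_neq0.
exists (\matrix_(i, j) numq (q%:~R * A i j)).
apply/matrixP => i j; rewrite !mxE.
apply/esym/numqK; rewrite {}/q (bigD1 i) //= (bigD1 j) //=.
rewrite -mulrA rmorphM /= mulrAC.
by rewrite rpredM ?intr_int // mulrC -numqE intr_int.
Qed.

(** Gaussian elimination does not leave the field of the entries, so the rows of the rational
    [kermx] still span the kernel over [F]. Clearing denominators makes these rows integral. *)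
Lemma int_kernel_span (F : numFieldType) p n
    (A : 'M[int]_(p, n)) (x : 'cV[F]_n) :
    map_mx intr A *m x = 0 ->
  exists k (a : 'I_k -> F) (v : 'I_k -> 'cV[int]_n),
    (forall i, A *m v i = 0) /\ x = \sum_i a i *: map_mx intr (v i).
Proof.
move=> Ax; pose B : 'M[rat]_(n, p) := map_mx intr A^T.
have ratr_intr m q (C : 'M[int]_(m, q)) :
    map_mx (ratr : rat -> F) (map_mx intr C) = map_mx intr C.
  by apply/matrixP => i j; rewrite !mxE ratr_int.
have : (x^T <= kermx (map_mx (ratr : rat -> F) B))%MS.
  by apply/sub_kermxP; rewrite ratr_intr -map_trmx -trmx_mul Ax trmx0.
rewrite -map_kermx => /submxP[D xD].
have [q q0 [V VE]] := rat_common_denom (kermx B).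
(* [D] expresses [x^T] in the rows of the rational kernel; dividing by [q] compensates for the
   cleared denominators. *)
exists n, (fun i => D 0 i / q%:~R), (fun i => (row i V)^T); split=> [i|].
  have VB : V *m A^T = 0.
    have : map_mx intr (V *m A^T) = 0 :> 'M[rat]_(n, p).
      by rewrite map_mxM /= -VE -scalemxAl mulmx_ker scaler0.
    move=> /matrixP VA; apply/matrixP => k l; apply/eqP.
    have := VA k l; rewrite [LHS]mxE [RHS]mxE [X in _ == X]mxE => /eqP.
    by rewrite intr_eq0.
  by apply: trmx_inj; rewrite trmx_mul trmxK -row_mul VB row0 trmx0.
apply: trmx_inj; rewrite xD mulmx_sum_row raddf_sum; apply: eq_bigr => i _ /=.
rewrite linearZ /= map_trmx trmxK -scalerA; congr (_ *: _).
apply: (@scalerI _ _ (q%:~R : F)); rewrite ?intr_eq0 //.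
rewrite scalerA divff ?intr_eq0 //.
rewrite scale1r map_row -ratr_intr -VE map_mxZ /= ratr_int.
by rewrite linearZ.
Qed.

Lemma mulr_sandwichB (R : nzRingType) (s t x y : R) :
  s * (x - y) * t = s * (x * t) - s * (y * t).
Proof. by rewrite mulrBr mulrBl !mulrA. Qed.

Lemma mulr_sandwichD (R : nzRingType) (s t x y : R) :
  s * (x + y) * t = s * x * t + s * y * t.
Proof. by rewrite mulrDr mulrDl. Qed.

Lemma mulr_sum_sandwich (R : nzRingType) (I J : Type) (r : seq I) (r' : seq J)
    (F : I -> R) (G : J -> R) (a : I -> int) (b : J -> int) (s t x : R) :
  s * ((\sum_(i <- r) F i *~ a i) * x * (\sum_(j <- r') G j *~ b j)) * t =
  \sum_(i <- r) \sum_(j <- r') (s * F i * x * (G j * t)) *~ a i *~ b j.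
Proof.
rewrite 2!mulr_suml mulr_sumr mulr_suml; apply: eq_bigr => i _.
rewrite mulr_sumr mulr_sumr mulr_suml; apply: eq_bigr => j _.
by rewrite !(mulrzAl, mulrzAr) !mulrA.
Qed.

(** * Class sums and membership in a bijectivization ideal *)

Section Ideals.
Variables (N d : nat).
Implicit Types (J : set (ncpoly N)) (s : seq 'I_N) (C : {set d.-tuple 'I_N}).

Lemma word_cat s1 s2 : word (s1 ++ s2) = word s1 * word s2.
Proof.
rewrite /word malgM_def fgmulUU mulr1; congr << _ *g _ >>.
by apply/eqP; rewrite fmP fmM.
Qed.

Lemma word_nil : word [::] = 1 :> ncpoly N.
Proof. by rewrite /word -fmoneE. Qed.

Lemma mcoeff_word s (k : {fmonom 'I_N}) : (word s)@_k = (k == s :> seq 'I_N)%:R.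
Proof. by rewrite /word mcoeffU1 eq_sym fmP. Qed.

(** Coefficients enter as integer multiples, which every additive map respects. *)
Lemma ncpolyE (x : ncpoly N) : x = \sum_(k <- msupp x) word k *~ x@_k.
Proof.
rewrite {1}[x]monalgE; apply: eq_bigr => k _.
apply/malgP => k'; rewrite raddfMz /= mcoeffU /word fmK mcoeffU1.
by rewrite mulrzz mulrC mulr_natr.
Qed.

Local Opaque word.

Lemma homog_compE (x : ncpoly N) :
  (forall k, k \in msupp x -> size k = d) ->
  x = \sum_(w : d.-tuple 'I_N) x@_(FMonom w) *: word w.
Proof.
move=> xd; apply/malgP => k; rewrite raddf_sum /=.
rewrite (eq_bigr (fun w : d.-tuple 'I_N =>
  x@_(FMonom w) * (k == w :> seq 'I_N)%:R)); last first.
  by move=> w _; rewrite mcoeffZ mcoeff_word.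
have [kd|kd] := eqVneq (size k) d.
  rewrite (bigD1 (tcast kd (in_tuple k))) //= val_tcast eqxx mulr1 fmK.
  rewrite big1 ?addr0 // => w; rewrite -val_eqE /= val_tcast eq_sym.
  by move=> /negPf ->; rewrite mulr0.
rewrite mcoeff_outdom; last by apply: contra kd => /xd ->.
rewrite big1 // => w _.
by case: eqP => [kw|]; rewrite ?mulr0 //; rewrite kw size_tuple eqxx in kd.
Qed.

Section TwoSidedIdeal.
Variable J : set (ncpoly N).
Hypothesis Jideal : two_sided_ideal J.

Lemma ideal0 : J 0. Proof. by case: Jideal. Qed.

Lemma idealD x y : J x -> J y -> J (x + y).
Proof. by case: Jideal => _ + _; apply. Qed.

Lemma idealM a x b : J x -> J (a * x * b).
Proof. by case: Jideal => _ _; apply. Qed.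

Lemma idealZ (n : int) x : J x -> J (n *: x).
Proof. by move=> /(idealM n%:MP 1); rewrite mulr1 mul_malgC. Qed.

Lemma idealB x y : J x -> J y -> J (x - y).
Proof. by move=> Jx /(idealZ (-1)); rewrite scaleN1r; apply: idealD. Qed.

Lemma ideal_sum (I : Type) (r : seq I) (P : pred I) (F : I -> ncpoly N) :
  (forall i, P i -> J (F i)) -> J (\sum_(i <- r | P i) F i).
Proof. by move=> JF; apply: big_ind => //; [exact: ideal0|exact: idealD]. Qed.

Lemma word_equiv_equivalence :
  {in [set: d.-tuple 'I_N]%SET & &,
    equivalence_rel (fun v w : d.-tuple 'I_N => word_equiv J v w)}.
Proof.
move=> u v w _ _ _; split; first by apply/asboolP; rewrite subrr; exact: ideal0.
move=> /asboolP uv; apply/asboolP/asboolP => [uw|vw].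
  by have := idealB uw uv; rewrite opprB addrC addrA subrK.
by have := idealD uv vw; rewrite addrA subrK.
Qed.

Lemma nonzero_classesP C : C \in nonzero_classes d J ->
  exists2 v : d.-tuple 'I_N, v \in C & forall w, (w \in C) = word_equiv J v w.
Proof.
rewrite inE => /andP[/imsetP[v _ ->] _].
have vP w : (w \in [set w in [set: d.-tuple 'I_N] | word_equiv J v w]%SET)
   = word_equiv J v w by rewrite !inE.
exists v => //; rewrite vP; apply/asboolP; rewrite subrr; exact: ideal0.
Qed.

Lemma nonzero_classes_trivIset : finset.trivIset (nonzero_classes d J).
Proof.
have /and3P[_ + _] := equivalence_partitionP word_equiv_equivalence.
by apply: trivIsetS; apply/fintype.subsetP => C; rewrite inE => /andP[].
Qed.

Lemma class_word C (v : d.-tuple 'I_N) :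
  C \in nonzero_classes d J -> v \in C -> ~ J (word v).
Proof. by rewrite inE => /andP[_ /forall_inP CJ] /CJ /asboolP. Qed.

Lemma class_word_equiv C (v w : d.-tuple 'I_N) : C \in nonzero_classes d J ->
  J (word v - word w) -> (v \in C) = (w \in C).
Proof.
move=> /nonzero_classesP[u _ CE] Jvw; rewrite !CE.
apply/asboolP/asboolP => Ju.
  by have := idealD Ju Jvw; rewrite addrA subrK.
by have := idealB Ju Jvw; rewrite opprB addrA subrK.
Qed.

(** Modulo [J], all words of a class equal one representative, so the part of [x] on that class
    reduces to its coefficient sum times this word, which is zero. The remaining words have a
    repeated letter and lie in [J]. *)
Lemma class_sums_mem (x : ncpoly N) :
    (forall s, ~~ uniq s -> J (word s)) ->
    finset.cover (nonzero_classes d J) = distinct_words N d ->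
    (forall k, k \in msupp x -> size k = d) ->
    (forall C, C \in nonzero_classes d J -> \sum_(w in C) x@_(FMonom w) = 0) ->
  J x.
Proof.
move=> Jrep cover_classes /homog_compE xE Cx; rewrite xE.
rewrite (bigID (mem (distinct_words N d))) /=; apply: idealD; last first.
  by apply: ideal_sum => w; rewrite inE => /Jrep; apply: idealZ.
rewrite -cover_classes (big_trivIset _ nonzero_classes_trivIset) /=.
apply: ideal_sum => C CJ; have [v vC CE] := nonzero_classesP CJ.
rewrite (eq_bigr (fun w : d.-tuple 'I_N => x@_(FMonom w) *: word v
   - x@_(FMonom w) *: (word v - word w))); last first.
  by move=> w _; rewrite scalerBr subKr.
rewrite sumrB; apply: idealB; last first.
  by apply: ideal_sum => w; rewrite CE => /asboolP; apply: idealZ.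
by rewrite -scaler_suml Cx // scale0r; exact: ideal0.
Qed.

End TwoSidedIdeal.

Lemma ideal_gen_two_sided (S : set (ncpoly N)) : two_sided_ideal (ideal_gen S).
Proof.
split=> [I [[]]//|x y Sx Sy I IS|a x b Sx I IS].
  by case: (IS) => -[_ + _] _; apply; [exact: Sx|exact: Sy].
by case: (IS) => -[_ _ +] _; apply; exact: Sx.
Qed.

Lemma bijectivization_ideal J : bijectivization J -> two_sided_ideal J.
Proof. by move=> [_ [G _ ->]]; exact: ideal_gen_two_sided. Qed.

Lemma bijectivization_repeated J s :
  bijectivization J -> ~~ uniq s -> J (word s).
Proof. by move=> [+ _] Us; apply=> I [_]; apply; right; exists s. Qed.

Definition class_sum C (x : ncpoly N) : int := \sum_(w in C) x@_(FMonom w).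

Lemma class_sum_is_additive C : additive (class_sum C).
Proof.
by move=> x y; rewrite -sumrB; apply: eq_bigr => w _; rewrite mcoeffB.
Qed.

HB.instance Definition _ C :=
  GRing.isAdditive.Build (ncpoly N) int (class_sum C) (class_sum_is_additive C).

Lemma class_sumD C : {morph class_sum C : x y / x + y}.
Proof. exact: raddfD. Qed.

Lemma class_sumB C : {morph class_sum C : x y / x - y}.
Proof. exact: raddfB. Qed.

Lemma class_sumMz C n : {morph class_sum C : x / x *~ n}.
Proof. exact: raddfMz. Qed.

Lemma class_sum_sum C (I : Type) (r : seq I) (F : I -> ncpoly N) :
  class_sum C (\sum_(i <- r) F i) = \sum_(i <- r) class_sum C (F i).
Proof. exact: raddf_sum. Qed.

Lemma class_sum_word C s :
  class_sum C (word s) = [exists w in C, tval w == s]%:R.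
Proof.
rewrite /class_sum.
have [/exists_inP[v vC /eqP <-]|] := boolP [exists w in C, tval w == s].
  rewrite (bigD1 v) //= mcoeff_word eqxx big1 ?addr0 // => w /andP[_ wv].
  by rewrite mcoeff_word -[_ == _]/(w == v) (negPf wv).
move=> /exists_inPn Cs; rewrite big1 // => w /Cs sw.
by rewrite mcoeff_word (negPf sw).
Qed.

(** It suffices to test generators placed in a context of words. A word of [J] belongs to no nonzero
    class, and the two words of a binomial in [J] are equivalent, so [C] contains both or
    neither. *)
Lemma class_sum_mem J C (x : ncpoly N) :
  bijectivization J -> C \in nonzero_classes d J -> J x -> class_sum C x = 0.
Proof.
move=> bijJ CJ; have Jid := bijectivization_ideal bijJ.
have [_ [G GB JE]] := bijJ.
(* The vanishing of a class sum is not stable under multiplication, hence the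
   quantification over all contexts [s], [t]. *)
pose K : set (ncpoly N) :=
  [set y : ncpoly N | forall s t, class_sum C (word s * y * word t) = 0].
suff JK : J `<=` K.
  by move=> /JK /(_ [::] [::]); rewrite word_nil mul1r mulr1.
rewrite JE => y; apply; split=> [|z Gz s t].
  split=> [s t|y1 y2 K1 K2 s t|a y1 b K1 s t].
  - by rewrite mulr0 mul0r raddf0.
  - rewrite mulr_sandwichD.
    by rewrite class_sumD -[RHS](addr0 0); congr (_ + _); [exact: K1|exact: K2].
  (* Once [a] and [b] are expanded into words, these words are absorbed into the contexts [s] and
     [t]. *)
  rewrite [a]ncpolyE [b]ncpolyE mulr_sum_sandwich class_sum_sum big1 // => k _.
  rewrite class_sum_sum big1 // => k' _.
  by rewrite !class_sumMz -!word_cat K1 !mul0rz.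
have Jz : J z by rewrite JE => I [_]; apply.
have [[u zE]|[u [v [uv zE]]]] := GB _ Gz; subst z.
  rewrite -!word_cat class_sum_word; case: exists_inP => // -[w wC /eqP wE].
  by case: (class_word CJ wC); rewrite wE !word_cat; apply: idealM.
have := idealM Jid (word s) (word t) Jz.
rewrite mulr_sandwichB -4!word_cat => Jc.
(* The equality of lengths makes [q] a [d]-tuple, so that membership in [C] can be transferred to
   it. *)
have imp p q : size p = size q -> J (word p - word q) ->
    [exists w in C, tval w == p] -> [exists w in C, tval w == q].
  move=> pq Jpq /exists_inP[w wC /eqP wp].
  have qd : size q == d by rewrite -pq -wp size_tuple.
  have Jwq : J (word w - word (Tuple qd)) by move: Jpq; rewrite -wp.
  apply/exists_inP; exists (Tuple qd) => //.
  by rewrite -(class_word_equiv Jid CJ Jwq).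
have suv : size (s ++ u ++ t) = size (s ++ v ++ t) by rewrite !size_cat uv.
rewrite class_sumB !class_sum_word; apply/eqP; rewrite subr_eq0; apply/eqP.
congr (nat_of_bool _)%:R; apply/idP/idP.
  exact: imp suv Jc.
apply: (imp _ _ (esym suv)).
by have := idealB Jid (ideal0 Jid) Jc; rewrite sub0r opprB.
Qed.

End Ideals.

(** * Duality for a cost vector that is the image of a positive dual vector *)

Section Duality.
Variables (R : realType) (p m : nat) (A : 'M[R]_(p, m)) (s : 'cV[R]_m).
Variable y0 : 'cV[R]_p.
Hypothesis y0_gt0 : forall i, 0 < y0 i 0.
Let c := A^T *m y0.

Lemma dot_trmx (y : 'cV[R]_p) (x : 'cV[R]_m) :
  dot (A^T *m y) x = dot y (A *m x).
Proof. by rewrite /dot trmx_mul trmxK mulmxA. Qed.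

Lemma dotE n (x y : 'cV[R]_n) : dot x y = \sum_i x i 0 * y i 0.
Proof. by rewrite /dot mxE; apply: eq_bigr => i _; rewrite mxE. Qed.

Lemma dotC n (x y : 'cV[R]_n) : dot x y = dot y x.
Proof. by rewrite !dotE; apply: eq_bigr => i _; rewrite mulrC. Qed.

Lemma dotBr n (x y z : 'cV[R]_n) : dot x (y - z) = dot x y - dot x z.
Proof. by rewrite /dot mulmxBr !mxE. Qed.

Lemma dot_ge0 n (x y : 'cV[R]_n) : lev 0 x -> lev 0 y -> 0 <= dot x y.
Proof.
move=> x0 y0'; rewrite dotE; apply: sumr_ge0 => i _.
by rewrite mulr_ge0 //; [have := x0 i|have := y0' i]; rewrite mxE.
Qed.

(** The difference of the objectives is the pairing of [y0] with [A *m (x - s)], both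
    nonnegative. *)
Lemma primal_objective_ge x : lev (A *m s) (A *m x) -> dot c s <= dot c x.
Proof.
move=> sx; rewrite -subr_ge0 -dotBr /c dot_trmx mulmxBr; apply: dot_ge0 => i.
  by rewrite mxE ltW.
by have := sx i; rewrite -subr_ge0 !mxE.
Qed.

(* A Farkas certificate against [A x = A s], [x >= 0] is shifted by a large
   multiple of [y0] to become nonnegative, which makes it dual feasible. *)
Lemma eq_feasible_of_dual :
    (forall y, lev 0 y -> lev (A^T *m y) c -> 0 <= dot s (c - A^T *m y)) ->
  exists2 x, A *m x = A *m s & lev 0 x.
Proof.
move=> dual_le; have [z zA|x x0 xE] := @farkas R p m A (A *m s); last first.
  by exists x => // i; rewrite mxE.
(* The sum makes [t *: y0 + z^T] nonnegative; the summand 1 keeps [t] positive. *)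
pose t : R := 1 + \sum_i `|z 0 i| / y0 i 0.
have t0 : 0 < t.
  by rewrite ltr_wpDr // sumr_ge0 // => i _; rewrite divr_ge0 // ltW.
pose y := y0 + t^-1 *: z^T.
have cy : c - A^T *m y = - (t^-1 *: (z *m A)^T).
  by rewrite /y mulmxDr -/c opprD addNKr trmx_mul -scalemxAr.
have: 0 <= dot s (c - A^T *m y).
  apply: dual_le => i; last first.
    rewrite -subr_ge0.
    have -> : c i 0 - (A^T *m y) i 0 = (c - A^T *m y) i 0
      by rewrite [RHS]mxE [X in _ = _ + X]mxE.
    by rewrite cy mxE [X in - X]mxE [X in _ * X]mxE oppr_ge0;
       rewrite pmulr_rle0 ?invr_gt0.
  rewrite !mxE -(pmulr_rge0 _ t0) mulrDr mulVKf ?gt_eqF //.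
  have : - z 0 i <= t * y0 i 0.
    apply: (le_trans (ler_norm _)); rewrite normrN -ler_pdivrMr //.
    rewrite /t (bigD1 i) //= addrCA lerDl addr_ge0 // sumr_ge0 // => j _.
    by rewrite divr_ge0 // ltW.
  by rewrite -subr_ge0 opprK.
rewrite cy dotC /dot linearN /= linearZ /= trmxK mulNmx -scalemxAl -mulmxA.
by rewrite mxE [X in - X]mxE oppr_ge0 pmulr_rle0 ?invr_gt0.
Qed.

End Duality.

(** * Class matrices and real components of ideals *)

Section ClassMatrices.
Variables (R : realType) (N d : nat).
Local Notation m := (num_words N d).
Implicit Types (J : set (ncpoly N)) (w : d.-tuple 'I_N).

Definition word_index w : 'I_m := enum_rank w.

Lemma word_indexK w : nth_word (word_index w) = w.
Proof. exact: enum_rankK. Qed.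

Lemma nth_wordK (k : 'I_m) : word_index (nth_word k) = k.
Proof. exact: enum_valK. Qed.

Lemma sum_nth_word (V : nmodType) (F : d.-tuple 'I_N -> V) :
  \sum_(k < m) F (nth_word k) = \sum_w F w.
Proof.
by rewrite [RHS](reindex _ (onW_bij _ (enum_val_bij {: d.-tuple 'I_N}))).
Qed.

Lemma class_mx_coords J i (x : ncpoly N) :
  (class_mx R d J *m coords R d x) i 0 = (class_sum (enum_val i) x)%:~R.
Proof.
rewrite mxE (eq_bigr (fun k => if nth_word k \in enum_val i
  then ((x@_(FMonom (nth_word k)))%:~R : R) else 0)); last first.
  by move=> k _; rewrite !mxE; case: ifP; rewrite ?mul1r ?mul0r.
rewrite (sum_nth_word (fun w => if w \in enum_val i
  then ((x@_(FMonom w))%:~R : R) else 0)).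
by rewrite -big_mkcond /class_sum rmorph_sum.
Qed.

Lemma coordsB : {morph @coords R N d : x y / x - y >-> x - y}.
Proof. by move=> x y; apply/colP => i; rewrite !mxE mcoeffB rmorphB. Qed.

Lemma dot_coords_word (g : 'cV[R]_m) w :
  dot g (coords R d (word w)) = g (word_index w) 0.
Proof.
rewrite dotE (bigD1 (word_index w)) //= mxE mcoeff_word word_indexK eqxx mulr1.
rewrite big1 ?addr0 // => k kw; rewrite mxE mcoeff_word.
rewrite -[_ == _]/(nth_word k == w).
by rewrite -(inj_eq (can_inj word_indexK)) nth_wordK (negPf kw) mulr0.
Qed.

Lemma msupp_word w (k : {fmonom 'I_N}) : k \in msupp (word w) -> size k = d.
Proof.
rewrite -mcoeff_neq0 mcoeff_word pnatr_eq0 eqb0 negbK.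
by move=> /eqP ->; rewrite size_tuple.
Qed.

Lemma homog_compB J (x y : ncpoly N) : J (x - y) ->
  (forall k, k \in msupp x -> size k = d) ->
  (forall k, k \in msupp y -> size k = d) -> homog_comp d J (x - y).
Proof.
move=> Jxy xd yd; split=> // k.
move=> /(fsubsetP (msuppB_le _ _)); rewrite in_fsetU.
by case/orP; [exact: xd|exact: yd].
Qed.

Lemma homog_comp_real_comp J (x : ncpoly N) :
  homog_comp d J x -> real_comp R d J (coords R d x).
Proof.
move=> Jx; exists 1%N, (fun=> 1), (fun=> coords R d x).
by rewrite big_ord1 scale1r; split=> // _; exists x.
Qed.

Lemma real_comp_sub J J' : J `<=` J' -> real_comp R d J `<=` real_comp R d J'.
Proof.
move=> JJ' v [n [a [g [gJ ->]]]]; exists n, a, g; split=> // i.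
by have [x [Jx xd] <-] := gJ i; exists x => //; split=> //; apply: JJ'.
Qed.

(** A section of [coords] over the integer vectors: the ideals live over the integers, so only such
    vectors can be tested for membership. *)
Definition int_vec_ncpoly (v : 'cV[int]_m) : ncpoly N :=
  \sum_k v k 0 *: word (nth_word k).

Lemma mcoeff_int_vec_ncpoly v (k : {fmonom 'I_N}) :
  (int_vec_ncpoly v)@_k = \sum_i v i 0 * (k == nth_word i :> seq 'I_N)%:R.
Proof.
by rewrite raddf_sum; apply: eq_bigr => i _; rewrite /= mcoeffZ mcoeff_word.
Qed.

Lemma coords_int_vec v : coords R d (int_vec_ncpoly v) = map_mx intr v.
Proof.
apply/colP => k; rewrite !mxE mcoeff_int_vec_ncpoly (bigD1 k) //= eqxx mulr1.
rewrite big1 ?addr0 // => i ik; rewrite -[_ == _]/(nth_word k == nth_word i).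
by rewrite (inj_eq (can_inj nth_wordK)) eq_sym (negPf ik) mulr0.
Qed.

Lemma int_vec_ncpoly_homog v k : k \in msupp (int_vec_ncpoly v) -> size k = d.
Proof.
apply: contraTeq => kd; rewrite -mcoeff_eq0 mcoeff_int_vec_ncpoly.
rewrite big1 // => i _.
by case: eqP => [kw|]; rewrite ?mulr0 //; rewrite kw size_tuple eqxx in kd.
Qed.

Section OneIdeal.
Variable J : set (ncpoly N).
Hypothesis bijJ : bijectivization J.
Hypothesis coverJ : finset.cover (nonzero_classes d J) = distinct_words N d.
Let Jid := bijectivization_ideal bijJ.

Lemma class_mx_real_comp v : real_comp R d J v -> class_mx R d J *m v = 0.
Proof.
move=> [n [a [g [gJ ->]]]]; rewrite mulmx_sumr big1 // => i _.
have [x [Jx _] <-] := gJ i; rewrite -scalemxAr.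
suff -> : class_mx R d J *m coords R d x = 0 by rewrite scaler0.
apply/colP => j; rewrite class_mx_coords mxE.
by rewrite (class_sum_mem bijJ (enum_valP j) Jx).
Qed.

(** The entries of the matrix product are the class sums, and these vanish already over the
    integers. *)
Lemma int_vec_ncpoly_mem v :
  class_mx R d J *m map_mx intr v = 0 -> J (int_vec_ncpoly v).
Proof.
rewrite -coords_int_vec => /colP vJ; apply: (class_sums_mem Jid _ coverJ).
- by move=> s; apply: bijectivization_repeated.
- exact: int_vec_ncpoly_homog.
move=> C CJ; have := vJ (enum_rank_in CJ C); rewrite class_mx_coords mxE.
by rewrite enum_rankK_in // => /eqP; rewrite intr_eq0 => /eqP.
Qed.

Lemma class_index w : w \in distinct_words N d ->
  exists i : 'I_(num_classes d J), w \in (enum_val i : {set d.-tuple 'I_N}).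
Proof.
rewrite -coverJ => /finset.bigcupP[C CJ wC]; exists (enum_rank_in CJ C).
by rewrite enum_rankK_in.
Qed.

(** Classes are disjoint, so column [k] of the class matrix has its only nonzero entry in row
    [i]. *)
Lemma class_tr_mulE_in (y : 'cV[R]_(num_classes d J)) (k : 'I_m)
    (i : 'I_(num_classes d J)) :
  nth_word k \in (enum_val i : {set d.-tuple 'I_N}) ->
  ((class_mx R d J)^T *m y) k 0 = y i 0.
Proof.
move=> ki; rewrite mxE (bigD1 i) //= !mxE ki mul1r big1 ?addr0 // => j ji.
rewrite !mxE; case kj: (nth_word k \in _); last by rewrite mul0r.
have /finset.trivIsetP triv := @nonzero_classes_trivIset _ d _ Jid.
have := triv _ _ (enum_valP i) (enum_valP j).
rewrite (inj_eq enum_val_inj) eq_sym => /(_ ji) /pred0P /(_ (nth_word k)).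
by rewrite /= ki kj.
Qed.

Lemma class_tr_mulE_out (y : 'cV[R]_(num_classes d J)) (k : 'I_m) :
  nth_word k \notin distinct_words N d -> ((class_mx R d J)^T *m y) k 0 = 0.
Proof.
rewrite -coverJ => kJ; rewrite mxE big1 // => i _; rewrite !mxE.
case ki: (nth_word k \in _); last by rewrite mul0r.
by case/finset.bigcupP: kJ; exists (enum_val i); rewrite // enum_valP.
Qed.

Lemma cvecE : cvec R N d = (class_mx R d J)^T *m const_mx 1.
Proof.
apply/colP => k; rewrite [LHS]mxE.
have [/class_index[i ki]|kd] := boolP (nth_word k \in distinct_words N d).
  by rewrite (class_tr_mulE_in _ ki) mxE.
by rewrite class_tr_mulE_out.
Qed.

(** For [g] orthogonal to the real component of [J], this reads off the constant value of [g] on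
    each class. Classes are nonempty, so the default 0 does not occur. *)
Definition class_values (g : 'cV[R]_m) : 'cV[R]_(num_classes d J) :=
  \col_i if [pick w in (enum_val i : {set d.-tuple 'I_N})] is Some w
         then g (word_index w) 0 else 0.

Lemma class_values_nonneg g : lev 0 g -> lev 0 (class_values g).
Proof.
move=> g0 i; rewrite !mxE; case: pickP => // w _.
by have := g0 (word_index w); rewrite mxE.
Qed.

Lemma orth_class_values g :
  orth (real_comp R d J) g -> g = (class_mx R d J)^T *m class_values g.
Proof.
move=> gJ; apply/colP => k.
have [/class_index[i ki]|kd] := boolP (nth_word k \in distinct_words N d).
  rewrite (class_tr_mulE_in _ ki) mxE; case: pickP => [w wi|/(_ (nth_word k))].
    have [v _ vE] := nonzero_classesP Jid (enum_valP i).
    have Jkw : J (word (nth_word k) - word w).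
      move: ki wi; rewrite !vE => /asboolP Jvk /asboolP Jvw.
      by have := idealB Jid Jvw Jvk; rewrite opprB addrC addrA subrK.
    have Jh := homog_compB Jkw (@msupp_word _) (@msupp_word _).
    have := gJ _ (homog_comp_real_comp Jh).
    rewrite coordsB dotBr !dot_coords_word nth_wordK => /eqP.
    by rewrite subr_eq0 => /eqP.
  by rewrite ki.
rewrite class_tr_mulE_out //.
have Jk : homog_comp d J (word (nth_word k)).
  split; last exact: msupp_word.
  by apply: bijectivization_repeated => //; rewrite inE in kd.
by have := gJ _ (homog_comp_real_comp Jk); rewrite dot_coords_word nth_wordK.
Qed.

Lemma class_tr_orth (y : 'cV[R]_(num_classes d J)) :
  orth (real_comp R d J) ((class_mx R d J)^T *m y).
Proof.
by move=> v /class_mx_real_comp v0; rewrite dot_trmx v0 /dot mulmx0 mxE.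
Qed.

Lemma class_tr_nonneg (y : 'cV[R]_(num_classes d J)) :
  lev 0 y -> nonneg_vec ((class_mx R d J)^T *m y).
Proof.
move=> y0 k; rewrite !mxE; apply: sumr_ge0 => i _; rewrite !mxE mulr_ge0 //.
by have := y0 i; rewrite mxE.
Qed.

End OneIdeal.

Section Stacked.
Variables (l : nat) (J : 'I_l -> set (ncpoly N)).
Hypothesis bijJ : forall j, bijectivization (J j).
Hypothesis coverJ :
  forall j, finset.cover (nonzero_classes d (J j)) = distinct_words N d.

Lemma stacked_mulE n (v : 'M[R]_(m, n)) :
  stacked_mx R d J *m v = \mxcol_j (class_mx R d (J j) *m v).
Proof. exact: mxcol_mul. Qed.

Lemma stacked_mul_eq0 n (v : 'M[R]_(m, n)) :
  stacked_mx R d J *m v = 0 <-> forall j, class_mx R d (J j) *m v = 0.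
Proof.
have <- : \mxcol_j (0 : 'M[R]_(num_classes d (J j), n)) = 0 by rewrite mxcol0.
by rewrite stacked_mulE; split=> [/eq_mxcolP//|J0]; apply/eq_mxcolP.
Qed.

Lemma stacked_mx_int :
  exists A, stacked_mx R d J = map_mx intr (A : 'M[int]_(_, _)).
Proof.
exists (\mxcol_j \matrix_(i < num_classes d (J j), k < m)
  (nth_word k \in (enum_val i : {set d.-tuple 'I_N}))%:R).
by apply/matrixP => i k; rewrite !mxE; case: (_ \in _).
Qed.

Lemma real_comp_bigcap v :
  real_comp R d (\bigcap_j J j) v <-> stacked_mx R d J *m v = 0.
Proof.
split=> [Jv|].
  apply/stacked_mul_eq0 => j; apply: (class_mx_real_comp (bijJ j)).
  by apply: real_comp_sub Jv => x; apply.
have [A AE] := stacked_mx_int; rewrite AE.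
move=> /int_kernel_span[n [a [u [Au ->]]]].
exists n, a, (fun i => map_mx intr (u i)); split=> // i.
exists (int_vec_ncpoly (u i)); last exact: coords_int_vec.
split; last exact: int_vec_ncpoly_homog.
move=> j _; apply: (int_vec_ncpoly_mem (bijJ j) (coverJ j)).
have : stacked_mx R d J *m map_mx intr (u i) = 0.
  by rewrite AE -map_mxM Au map_mx0.
by move=> /stacked_mul_eq0.
Qed.

Lemma stacked_tr_mulE (y : 'cV[R]_(\sum_j num_classes d (J j))) :
  (stacked_mx R d J)^T *m y = \sum_j (class_mx R d (J j))^T *m submxcol y j.
Proof. by rewrite tr_mxcol -{1}[y]submxcolK mul_mxrow_mxcol. Qed.

Lemma stacked_tr_const : (0 < l)%N ->
  (stacked_mx R d J)^T *m const_mx l%:R^-1 = cvec R N d.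
Proof.
move=> l0; rewrite stacked_tr_mulE (eq_bigr (fun=> l%:R^-1 *: cvec R N d)).
  rewrite sumr_const card_ord -scaler_nat scalerA divff ?scale1r //.
  by rewrite pnatr_eq0 -lt0n.
move=> j _; rewrite (cvecE (bijJ j) (coverJ j)) scalemxAr; congr (_ *m _).
by apply/colP => i; rewrite !mxE mulr1.
Qed.

End Stacked.
End ClassMatrices.

Theorem theorem6p2 (R : realType) (N d : nat) (lam : seq nat) (l : nat)
    (J : 'I_l -> set (ncpoly N))
    (d_gt0 : (0 < d)%N) (lamP : is_partition d lam) (l_gt0 : (0 < l)%N)
    (bijJ : forall j, bijectivization (J j))
    (coverJ : forall j, finset.cover (nonzero_classes d (J j)) = distinct_words N d) :
  let m := num_words N d in
  let c : 'cV[R]_m := cvec R N d in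
  let s : 'cV[R]_m := coords R d (nc_schur N lam) in
  let M := dot c s in
  let RJ := real_comp R d (\bigcap_j J j) in
  [<-> [set coset RJ x | x in nonneg_vec] (coset RJ s);
       LP_cap_eq_feasible R d J lam !=set0;
       optimal_min c (LP_cap_feasible R d J lam) M;
       optimal_max (bvec R d J lam) (LP_cap_dual_feasible R d J) M;
       forall g, sum_sets (fun j => orth (real_comp R d (J j))
                                    `&` nonneg_vec) g ->
         lev g c -> 0 <= dot s (c - g)].
Proof.
move=> m c s M RJ.
pose A := stacked_mx R d J.
pose y0 : 'cV[R]_(\sum_j num_classes d (J j)) := const_mx l%:R^-1.
have y0_gt0 i : 0 < y0 i 0 by rewrite mxE invr_gt0 ltr0n.
have cE : A^T *m y0 = c := stacked_tr_const R bijJ coverJ l_gt0.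
have bE : bvec R d J lam = A *m s by rewrite /A stacked_mulE.
have RJE v : RJ v <-> A *m v = 0 := real_comp_bigcap bijJ coverJ v.
have dualE y : dot (bvec R d J lam) y = dot s (A^T *m y).
  by rewrite bE dotC -dot_trmx dotC.
tfae.
- move=> [x x0 xs]; exists x; split=> //; rewrite bE.
  have : coset RJ s s by rewrite /coset /= subrr; apply/RJE; rewrite mulmx0.
  rewrite -xs /coset /= => /RJE; rewrite mulmxBr => /eqP.
  by rewrite subr_eq0 => /eqP ->.
- move=> [x [Ax x0]]; split.
    exists x; first by split=> //; rewrite -Ax => i.
    by rewrite -cE dot_trmx [A *m x]Ax bE -dot_trmx cE.
  move=> z [zb _]; rewrite /M -cE; apply: primal_objective_ge => //.
  by rewrite -bE.
- move=> [[x [Ax x0] cx] _]; split.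
    exists y0; last by rewrite dualE cE dotC.
    split; first by rewrite -/A cE => i.
    by move=> i; rewrite mxE ltW.
  move=> y [yc yge0]; rewrite -cx.
  apply: (@le_trans _ _ (dot (A *m x) y)); last first.
    rewrite dotC -dot_trmx dotC [leRHS]dotC -subr_ge0 -dotBr.
    by apply: dot_ge0 => // i; have := yc i; rewrite -subr_ge0 !mxE.
  rewrite dotC [leRHS]dotC -subr_ge0 -dotBr.
  by apply: dot_ge0 => // i; have := Ax i; rewrite -subr_ge0 !mxE.
- move=> [_ dual_le] _ [g gJ <-] gc.
  pose y : 'cV[R]_(\sum_j num_classes d (J j)) :=
    \mxcol_j class_values (J j) (g j).
  have gE : \sum_j g j = A^T *m y.
    rewrite stacked_tr_mulE; apply: eq_bigr => j _; rewrite mxcolK.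
    by apply: orth_class_values (bijJ j) (coverJ j) _ _; case: (gJ j).
  rewrite gE dotBr subr_ge0 -dualE [leRHS]dotC; apply: dual_le; split.
    by rewrite -/A -gE.
  move=> i; rewrite !mxE.
  have [_ gj0] := gJ (tagnat.sig1 i).
  by have := class_values_nonneg gj0 (tagnat.sig2 i); rewrite !mxE.
- move=> g_le; have [|x Ax x0] := eq_feasible_of_dual (A := A) (s := s) y0_gt0.
    rewrite cE => y yge0 yc; apply: g_le => //; rewrite stacked_tr_mulE.
    exists (fun j => (class_mx R d (J j))^T *m submxcol y j) => // j.
    split; first exact: class_tr_orth.
    by apply: class_tr_nonneg => i; have := yge0 (tagnat.Rank j i);
       rewrite !mxE.
  exists x => //; apply/seteqP; split=> v /RJE; rewrite mulmxBr => vA;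
    apply/RJE.
    by rewrite mulmxBr -Ax.
  by rewrite mulmxBr Ax.
Qed.
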